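(* The arithmetic compactification $E_0(\mathbb N)$ is totally disconnected but not extremely disconnected (i.e., there is an open subset of $E_0(\mathbb N)$ whose closure is not open).
   Context: $\mathbb N=\{0,1,2,\ldots\}$ and $l^\infty(\mathbb N)$ is the C*-algebra of bounded complex-valued functions on $\mathbb N$. Let $(\sigma_Af)(n)=f(n+1)$. An anqie is a unital C*-subalgebra $\mathcal A\subseteq l^\infty(\mathbb N)$ with $\sigma_A(\mathcal A)\subseteq\mathcal A$; $\mathcal A_{\{f\}}$ is the smallest anqie containing $f$. For an anqie $\mathcal A$ with maximal ideal space $X$, $A:X\to X$, $(A\rho)(g)=\rho(\sigma_Ag)$, is continuous and the anqie entropy is $\mathrm{AE}(\mathcal A)=h(A)$ (topological entropy); $\mathrm{AE}(f)=\mathrm{AE}(\mathcal A_{\{f\}})$. Let $\mathcal E_0(\mathbb N)=\{f\in l^\infty(\mathbb N):\mathrm{AE}(f)=0\}$ (this is an anqie), and let $E_0(\mathbb N)$, the arithmetic compactification of $\mathbb N$, be the maximal ideal space of $\mathcal E_0(\mathbb N)$ with the weak* topology. Totally disconnected means any two distinct points are separated by a clopen set. *)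

(* Defs.v *)
From Stdlib Require Import Reals List ClassicalEpsilon.
Open Scope R_scope.

Record C : Type := mkC { Re : R ; Im : R }.
Definition C0 : C := mkC 0 0.
Definition C1 : C := mkC 1 0.
Definition Cadd (z w : C) : C := mkC (Re z + Re w) (Im z + Im w).
Definition Copp (z : C) : C := mkC (- Re z) (- Im z).
Definition Cmul (z w : C) : C :=
  mkC (Re z * Re w - Im z * Im w) (Re z * Im w + Im z * Re w).
Definition Cconj (z : C) : C := mkC (Re z) (- Im z).
Definition Cnorm (z : C) : R := sqrt (Re z * Re z + Im z * Im z).

Definition seqC := nat -> C.
Definition bounded (f : seqC) : Prop := exists M, forall n, Cnorm (f n) <= M.
Definition sconst (c : C) : seqC := fun _ => c.
Definition sadd (f g : seqC) : seqC := fun n => Cadd (f n) (g n).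
Definition sscal (c : C) (f : seqC) : seqC := fun n => Cmul c (f n).
Definition smul (f g : seqC) : seqC := fun n => Cmul (f n) (g n).
Definition sconj (f : seqC) : seqC := fun n => Cconj (f n).
Definition shift (f : seqC) : seqC := fun n => f (S n).

Record anqie (A : seqC -> Prop) : Prop := {
  anqie_bounded : forall f, A f -> bounded f ;
  anqie_unit : A (sconst C1) ;
  anqie_add : forall f g, A f -> A g -> A (sadd f g) ;
  anqie_scal : forall c f, A f -> A (sscal c f) ;
  anqie_mul : forall f g, A f -> A g -> A (smul f g) ;
  anqie_conj : forall f, A f -> A (sconj f) ;
  anqie_closed : forall g,
     (forall eps, 0 < eps -> exists h, A h /\
         forall n, Cnorm (Cadd (g n) (Copp (h n))) <= eps) -> A g ;
  anqie_shift : forall f, A f -> A (shift f)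
}.

Definition anqie_gen (f : seqC) : seqC -> Prop :=
  fun g => forall A, anqie A -> A f -> A g.

(** * Maximal ideal space.
    A point of the maximal ideal space of A is a nonzero (unital)
    multiplicative linear functional on A.  To make points Leibniz-comparable
    we represent such a functional as a total map on sequences which vanishes
    outside A (this is a bijective encoding). *)
Definition functional := seqC -> C.

Definition character (A : seqC -> Prop) (rho : functional) : Prop :=
  rho (sconst C1) = C1 /\
  (forall f g, A f -> A g -> rho (sadd f g) = Cadd (rho f) (rho g)) /\
  (forall c f, A f -> rho (sscal c f) = Cmul c (rho f)) /\
  (forall f g, A f -> A g -> rho (smul f g) = Cmul (rho f) (rho g)) /\
  (forall f, ~ A f -> rho f = C0).

Definition wopen (A : seqC -> Prop) (U : functional -> Prop) : Prop :=
  forall rho, U rho ->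
    character A rho /\
    exists (l : list seqC) (eps : R), 0 < eps /\ (forall f, In f l -> A f) /\
      forall sigma, character A sigma ->
        (forall f, In f l -> Cnorm (Cadd (sigma f) (Copp (rho f))) < eps) ->
        U sigma.

Definition wclosure (A : seqC -> Prop) (U : functional -> Prop) :
  functional -> Prop :=
  fun rho => character A rho /\
    forall V, wopen A V -> V rho -> exists sigma, V sigma /\ U sigma.

Definition wclopen (A : seqC -> Prop) (U : functional -> Prop) : Prop :=
  wopen A U /\ wopen A (fun rho => character A rho /\ ~ U rho).

Definition totally_disconnected (A : seqC -> Prop) : Prop :=
  forall rho sigma, character A rho -> character A sigma -> rho <> sigma ->
    exists U, wclopen A U /\ U rho /\ ~ U sigma.

Definition extremely_disconnected (A : seqC -> Prop) : Prop :=
  forall U, wopen A U -> wopen A (wclosure A U).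

Definition Tshift (A : seqC -> Prop) (rho : functional) : functional :=
  fun g => if excluded_middle_informative (A g) then rho (shift g) else C0.

(** * Topological entropy (Adler–Konheim–McAndrew) of Tshift on the
    maximal ideal space.  For an open cover U = (U_i)_{i in I}, the join
    U v T^{-1}U v ... v T^{-(n-1)}U has members indexed by words w. *)
Definition open_cover (A : seqC -> Prop) {I : Type}
  (U : I -> functional -> Prop) : Prop :=
  (forall i, wopen A (U i)) /\
  (forall rho, character A rho -> exists i, U i rho).

Definition join_set (A : seqC -> Prop) {I : Type} (U : I -> functional -> Prop)
  (n : nat) (w : nat -> I) : functional -> Prop :=
  fun rho => character A rho /\
    forall i, (i < n)%nat -> U (w i) (Nat.iter i (Tshift A) rho).

Definition covnum_le (A : seqC -> Prop) {I : Type} (U : I -> functional -> Prop)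
  (n k : nat) : Prop :=
  exists ws : list (nat -> I), (length ws <= k)%nat /\
    forall rho, character A rho -> exists w, In w ws /\ join_set A U n w rho.

(** h(T) = 0, i.e. for every open cover U,
    lim_n (1/n) log N(U v ... v T^{-(n-1)}U) = 0. *)
Definition zero_entropy (A : seqC -> Prop) : Prop :=
  forall (I : Type) (U : I -> functional -> Prop), open_cover A U ->
    forall eps, 0 < eps -> exists N0 : nat, forall n : nat, (N0 <= n)%nat ->
      exists k : nat, covnum_le A U n k /\ INR k <= exp (eps * INR n).

Definition E0 : seqC -> Prop :=
  fun f => bounded f /\ zero_entropy (anqie_gen f).

(* Main.v *)
(** The function f has anqie entropy zero exactly when, up to any eps > 0, it has
    only exp(o(n)) different windows (f(m), ..., f(m+n-1)); this rests on the
    density of the point evaluations in the maximal ideal space and on its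
    compactness.

    Two characters that differ at f in E_0(N) are separated by an idempotent: f is
    uniformly close to f o H for a map H : N -> N whose aligned blocks are so few,
    at arbitrarily large lengths, that every function of H has entropy zero, in
    particular the indicator of {m : f(H m) is near rho(f)}.

    The evaluations at points of N are isolated, so each S in N spans an open set.
    If its closure were open, then by compactness the indicator of S would be
    determined by approximate values of finitely many functions of entropy zero,
    hence would have entropy zero itself; but this fails for a sequence in which
    every finite 0-1 word occurs. *)

Require Import Defs.
From Stdlib Require Import Reals List ClassicalEpsilon.
From Stdlib Require Import FunctionalExtensionality PropExtensionality Lra Lia.
From Coquelicot Require Complex.
From mathcomp Require filter.
(* Stdlib also defines a [C1]; this restores the one of [Defs]. *)
Import Defs.

Lemma choice {X Y : Type} (P : X -> Y -> Prop) :
  (forall x, exists y, P x y) -> exists f, forall x, P x (f x).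
Proof.
intros H.
exists (fun x => proj1_sig (constructive_indefinite_description _ (H x))).
intros x; exact (proj2_sig (constructive_indefinite_description _ (H x))).
Qed.

(** * Complex numbers *)

Notation Cdist z w := (Cnorm (Cadd z (Copp w))).

Lemma C_ring : ring_theory C0 C1 Cadd Cmul (fun z w => Cadd z (Copp w)) Copp eq.
Proof.
constructor; intros; repeat match goal with z : C |- _ => destruct z end;
  unfold Cadd, Cmul, Copp, C0, C1; simpl; f_equal; ring.
Qed.
Add Ring C_ring : C_ring.

Definition toC (z : C) : Complex.C := (Re z, Im z).

Lemma Cnorm_toC z : Cnorm z = Complex.Cmod (toC z).
Proof. unfold Cnorm, Complex.Cmod, toC; simpl; f_equal; ring. Qed.

Lemma Cnorm_triangle z w : Cnorm (Cadd z w) <= Cnorm z + Cnorm w.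
Proof. rewrite !Cnorm_toC. exact (Complex.Cmod_triangle (toC z) (toC w)). Qed.

Lemma Cnorm_mul z w : Cnorm (Cmul z w) = Cnorm z * Cnorm w.
Proof. rewrite !Cnorm_toC. exact (Complex.Cmod_mult (toC z) (toC w)). Qed.

Lemma Cnorm_pos z : 0 <= Cnorm z.
Proof. apply sqrt_pos. Qed.

Lemma Cnorm_sqr z : Cnorm z * Cnorm z = Re z * Re z + Im z * Im z.
Proof. apply sqrt_sqrt. nra. Qed.

Lemma Cnorm_real x : Cnorm (mkC x 0) = Rabs x.
Proof.
unfold Cnorm; simpl. rewrite Rmult_0_l, Rplus_0_r. exact (sqrt_Rsqr_abs x).
Qed.

Lemma Cnorm_opp z : Cnorm (Copp z) = Cnorm z.
Proof. unfold Cnorm; simpl; f_equal; ring. Qed.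

Lemma Cnorm_conj z : Cnorm (Cconj z) = Cnorm z.
Proof. unfold Cnorm; simpl; f_equal; ring. Qed.

Lemma Re_le_Cnorm z : Rabs (Re z) <= Cnorm z.
Proof.
apply Rsqr_incr_0_var; [|apply Cnorm_pos].
unfold Rsqr. rewrite Cnorm_sqr, <- Rabs_mult, Rabs_pos_eq; nra.
Qed.

Lemma Im_le_Cnorm z : Rabs (Im z) <= Cnorm z.
Proof.
apply Rsqr_incr_0_var; [|apply Cnorm_pos].
unfold Rsqr. rewrite Cnorm_sqr, <- Rabs_mult, Rabs_pos_eq; nra.
Qed.

Lemma Cnorm_le_Re_Im z : Cnorm z <= Rabs (Re z) + Rabs (Im z).
Proof.
pose proof (Rabs_pos (Re z)). pose proof (Rabs_pos (Im z)).
apply Rsqr_incr_0_var; [|lra].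
unfold Rsqr. rewrite Cnorm_sqr.
assert (E : forall x, x * x = Rabs x * Rabs x)
  by (intros x; rewrite <- Rabs_mult, Rabs_pos_eq; nra).
rewrite (E (Re z)), (E (Im z)). nra.
Qed.

Lemma Cdist_refl z : Cdist z z = 0.
Proof.
replace (Cadd z (Copp z)) with (mkC 0 0) by (symmetry; exact (Ropp_def C_ring z)).
now rewrite Cnorm_real, Rabs_R0.
Qed.

Lemma Cdist_sym z w : Cdist z w = Cdist w z.
Proof.
rewrite <- Cnorm_opp. f_equal. ring.
Qed.

Lemma Cdist_triangle u z w : Cdist u w <= Cdist u z + Cdist z w.
Proof.
replace (Cadd u (Copp w)) with (Cadd (Cadd u (Copp z)) (Cadd z (Copp w))) by ring.
apply Cnorm_triangle.
Qed.

Lemma Cdist_eq0 z w : Cdist z w <= 0 -> z = w.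
Proof.
intros H. pose proof (Cnorm_sqr (Cadd z (Copp w))) as E.
pose proof (Cnorm_pos (Cadd z (Copp w))).
replace (Cdist z w) with 0 in E by lra.
destruct z as [a b], w as [c d]; simpl in E.
rewrite Rmult_0_l in E. symmetry in E. apply Rplus_sqr_eq_0 in E.
f_equal; lra.
Qed.

Lemma Cdist_add u v z w : Cdist (Cadd u v) (Cadd z w) <= Cdist u z + Cdist v w.
Proof.
replace (Cadd (Cadd u v) (Copp (Cadd z w)))
  with (Cadd (Cadd u (Copp z)) (Cadd v (Copp w))) by ring.
apply Cnorm_triangle.
Qed.

Lemma Cdist_mul u v z w :
  Cdist (Cmul u v) (Cmul z w) <= Cnorm u * Cdist v w + Cnorm w * Cdist u z.
Proof.
replace (Cadd (Cmul u v) (Copp (Cmul z w)))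
  with (Cadd (Cmul u (Cadd v (Copp w))) (Cmul w (Cadd u (Copp z)))) by ring.
rewrite <- !Cnorm_mul. apply Cnorm_triangle.
Qed.

Lemma Cdist_scal c z w : Cdist (Cmul c z) (Cmul c w) = Cnorm c * Cdist z w.
Proof. rewrite <- Cnorm_mul. f_equal. ring. Qed.

Lemma Cdist_conj z w : Cdist (Cconj z) (Cconj w) = Cdist z w.
Proof.
rewrite <- (Cnorm_conj (Cadd z _)). f_equal.
unfold Cadd, Cconj, Copp; simpl; f_equal; ring.
Qed.

(** * Window complexity *)

(** A partition of the windows rather than a cover by balls: colours of several sequences combine
    into pairs, and no centres have to be chosen. *)
Definition window_coloring (f : seqC) (n : nat) (eps : R) (c : nat -> nat) : Prop :=
  forall m m', c m = c m' ->
    forall i, (i < n)%nat -> Cdist (f (m + i)%nat) (f (m' + i)%nat) <= eps.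

(** Finite families are considered because a basic weak* neighbourhood tests finitely many
    functions. *)
Definition jointly_low (l : list seqC) : Prop :=
  forall eps delta, 0 < eps -> 0 < delta ->
    exists N0, forall n, (N0 <= n)%nat -> exists k c,
      INR k <= exp (delta * INR n) /\ (forall m, (c m < k)%nat) /\
      forall f, In f l -> window_coloring f n eps c.

(* Subexponential growth of the number of colours needed to describe all
   length-n windows of f up to eps: the combinatorial form of AE(f) = 0. *)
Definition low_complexity (f : seqC) : Prop := jointly_low (f :: nil).

(** Pairs of colours, one for [f] and one for the remaining list, are coded as [k2 * c1 + c2]. The
    numbers of colours multiply, so each factor gets half of the growth rate. *)
Lemma jointly_low_all l : (forall f, In f l -> low_complexity f) -> jointly_low l.
Proof.
induction l as [|f l IH]; intros H eps delta He Hd.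
- exists 0%nat. intros n _. exists 1%nat, (fun _ => 0%nat).
  split; [|split; [intros; lia | intros f []]].
  pose proof (exp_ineq1_le (delta * INR n)). pose proof (pos_INR n).
  simpl INR. nra.
- destruct (H f (or_introl eq_refl) eps (delta / 2)) as [N1 H1]; [easy|lra|].
  destruct (IH (fun g Hg => H g (or_intror Hg)) eps (delta / 2)) as [N2 H2]; [easy|lra|].
  exists (N1 + N2)%nat. intros n Hn.
  destruct (H1 n) as (k1 & c1 & B1 & L1 & C1); [lia|].
  destruct (H2 n) as (k2 & c2 & B2 & L2 & C2); [lia|].
  exists (k1 * k2)%nat, (fun m => (k2 * c1 m + c2 m)%nat).
  split; [|split].
  + rewrite mult_INR.
    replace (delta * INR n) with (delta / 2 * INR n + delta / 2 * INR n) by field.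
    rewrite exp_plus. apply Rmult_le_compat; auto using pos_INR.
  + intros m. specialize (L1 m). specialize (L2 m). nia.
  + intros g Hg m m' E.
    destruct (Nat.div_mod_unique k2 (c1 m) (c1 m') (c2 m) (c2 m')) as [E1 E2]; auto.
    destruct Hg as [<-|Hg]; [apply (C1 f (or_introl eq_refl)) | apply (C2 g Hg)]; auto.
Qed.

(** A colouring of the windows of [l] at precision [eta] serves [g] at precision [eps], because the
    domination acts position by position. *)
Lemma low_complexity_dominated g :
  (forall eps, 0 < eps -> exists l eta, 0 < eta /\
     (forall f, In f l -> low_complexity f) /\
     forall m m', (forall f, In f l -> Cdist (f m) (f m') <= eta) ->
       Cdist (g m) (g m') <= eps) ->
  low_complexity g.
Proof.
intros H eps delta He Hd.
destruct (H eps He) as (l & eta & Heta & Hl & D).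
destruct (jointly_low_all l Hl eta delta Heta Hd) as [N0 HN].
exists N0. intros n Hn. destruct (HN n Hn) as (k & c & B & L & W).
exists k, c. split; [|split]; auto.
intros g' [<-|[]] m m' E i Hi. apply D. intros f Hf. now apply (W f Hf).
Qed.

Lemma low_complexity_shift f : low_complexity f -> low_complexity (shift f).
Proof.
intros H eps delta He Hd. destruct (H eps delta He Hd) as [N0 HN].
exists N0. intros n Hn. destruct (HN n Hn) as (k & c & B & L & W).
exists k, (fun m => c (S m)). split; [|split]; auto.
intros g' [<-|[]] m m' E i Hi.
exact (W f (or_introl eq_refl) (S m) (S m') E i Hi).
Qed.

(** * The anqie of bounded sequences of low complexity *)

Lemma anqie_linf : anqie bounded.
Proof.
constructor.
- auto.
- exists (Cnorm C1). intros; apply Rle_refl.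
- intros f g [M Hf] [M' Hg]. exists (M + M'). intros n.
  eapply Rle_trans; [apply Cnorm_triangle | apply Rplus_le_compat; auto].
- intros c f [M Hf]. exists (Cnorm c * M). intros n. unfold sscal. rewrite Cnorm_mul.
  apply Rmult_le_compat_l; auto using Cnorm_pos.
- intros f g [M Hf] [M' Hg]. exists (M * M'). intros n. unfold smul. rewrite Cnorm_mul.
  apply Rmult_le_compat; auto using Cnorm_pos.
- intros f [M Hf]. exists M. intros n. unfold sconj. rewrite Cnorm_conj. apply Hf.
- intros g H. destruct (H 1) as (h & [M Hh] & D); [lra|].
  exists (1 + M). intros n.
  replace (g n) with (Cadd (Cadd (g n) (Copp (h n))) (h n)) by ring.
  eapply Rle_trans; [apply Cnorm_triangle | apply Rplus_le_compat; auto].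
- intros f [M Hf]. exists M. intros n. apply Hf.
Qed.

(** By minimality, all of [anqie_gen f] lies in this anqie as soon as [f] does; so the complexity of
    the generator controls the entropy of the generated anqie. *)
Lemma anqie_low_complexity : anqie (fun f => bounded f /\ low_complexity f).
Proof.
assert (single : forall f : seqC, low_complexity f ->
   forall g, In g (f :: nil) -> low_complexity g).
{ intros f Hf g [<-|[]]; exact Hf. }
constructor.
- tauto.
- split; [apply (anqie_unit _ anqie_linf)|].
  apply low_complexity_dominated. intros eps He.
  exists nil, 1. split; [lra|]. split; [intros f []|].
  intros; unfold sconst. rewrite Cdist_refl. lra.
- intros f g [Bf Zf] [Bg Zg]. split; [now apply (anqie_add _ anqie_linf)|].
  apply low_complexity_dominated. intros eps He.
  exists (f :: g :: nil), (eps / 2). split; [lra|]. split.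
  + intros h [<-|[<-|[]]]; auto.
  + intros m m' H. eapply Rle_trans; [apply Cdist_add|].
    pose proof (H f ltac:(simpl; auto)). pose proof (H g ltac:(simpl; auto)). lra.
- intros c f [Bf Zf]. split; [now apply (anqie_scal _ anqie_linf)|].
  apply low_complexity_dominated. intros eps He. pose proof (Cnorm_pos c).
  exists (f :: nil), (eps / (Cnorm c + 1)). split; [apply Rdiv_lt_0_compat; lra|].
  split; [exact (single f Zf)|].
  intros m m' H'. unfold sscal. rewrite Cdist_scal.
  specialize (H' f ltac:(simpl; auto)).
  pose proof (Cnorm_pos (Cadd (f m) (Copp (f m')))).
  replace eps with ((Cnorm c + 1) * (eps / (Cnorm c + 1))) by (field; lra).
  apply Rmult_le_compat; lra.
- intros f g [Bf Zf] [Bg Zg]. split; [now apply (anqie_mul _ anqie_linf)|].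
  destruct Bf as [M Hf], Bg as [M' Hg].
  apply low_complexity_dominated. intros eps He.
  assert (HM : 0 <= M) by (eapply Rle_trans; [apply Cnorm_pos | apply (Hf 0%nat)]).
  assert (HM' : 0 <= M') by (eapply Rle_trans; [apply Cnorm_pos | apply (Hg 0%nat)]).
  exists (f :: g :: nil), (eps / (M + M' + 1)).
  split; [apply Rdiv_lt_0_compat; lra|]. split.
  + intros h [<-|[<-|[]]]; auto.
  + intros m m' H. eapply Rle_trans; [apply Cdist_mul|].
    pose proof (H f ltac:(simpl; auto)). pose proof (H g ltac:(simpl; auto)).
    set (eta := eps / (M + M' + 1)) in *.
    assert (0 < eta) by (apply Rdiv_lt_0_compat; lra).
    replace eps with ((M + M' + 1) * eta) by (unfold eta; field; lra).
    apply Rle_trans with (M * eta + M' * eta); [|nra].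
    apply Rplus_le_compat; apply Rmult_le_compat; auto using Cnorm_pos.
- intros f [Bf Zf]. split; [now apply (anqie_conj _ anqie_linf)|].
  apply low_complexity_dominated. intros eps He.
  exists (f :: nil), eps. split; [auto|]. split; [exact (single f Zf)|].
  intros m m' H'. unfold sconj. rewrite Cdist_conj. apply H'. simpl; auto.
- intros g H. split.
  + apply (anqie_closed _ anqie_linf). intros eps He.
    destruct (H eps He) as (h & [Bh _] & D). now exists h.
  + apply low_complexity_dominated. intros eps He.
    destruct (H (eps / 3)) as (h & [_ Zh] & D); [lra|].
    exists (h :: nil), (eps / 3). split; [lra|]. split; [exact (single h Zh)|].
    intros m m' H'. specialize (H' h ltac:(simpl; auto)).
    pose proof (D m). pose proof (D m') as D'. rewrite Cdist_sym in D'.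
    pose proof (Cdist_triangle (g m) (h m) (g m')).
    pose proof (Cdist_triangle (h m) (h m') (g m')). lra.
- intros f [Bf Zf]. split; [now apply (anqie_shift _ anqie_linf)|].
  now apply low_complexity_shift.
Qed.

(** * Characters *)

(** The default [C0] outside [A] is the one that [character] prescribes. *)
Definition evaluation (A : seqC -> Prop) (m : nat) : functional :=
  fun g => if excluded_middle_informative (A g) then g m else C0.

Lemma evaluation_in A m g : A g -> evaluation A m g = g m.
Proof. intros H. unfold evaluation. now destruct excluded_middle_informative. Qed.

Lemma evaluation_character A m : anqie A -> character A (evaluation A m).
Proof.
intros HA. repeat split.
- now rewrite evaluation_in by now apply (anqie_unit A HA).
- intros f g Hf Hg. now rewrite !evaluation_in by (auto; now apply (anqie_add A HA)).
- intros c f Hf. now rewrite !evaluation_in by (auto; now apply (anqie_scal A HA)).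
- intros f g Hf Hg. now rewrite !evaluation_in by (auto; now apply (anqie_mul A HA)).
- intros f Hf. unfold evaluation. now destruct excluded_middle_informative.
Qed.

Lemma anqie_const A c : anqie A -> A (sconst c).
Proof.
intros HA. replace (sconst c) with (sscal c (sconst C1)).
- now apply (anqie_scal A HA), (anqie_unit A HA).
- apply functional_extensionality; intros n. unfold sscal, sconst. ring.
Qed.

Lemma character_const A rho c : anqie A -> character A rho -> rho (sconst c) = c.
Proof.
intros HA (H1 & _ & Hs & _). replace (sconst c) with (sscal c (sconst C1)).
- rewrite Hs, H1 by now apply (anqie_unit A HA). ring.
- apply functional_extensionality; intros n. unfold sscal, sconst. ring.
Qed.

(** * Inverses of positive elements and density of the evaluations *)

Fixpoint geometric_sum (q : seqC) (k : nat) : seqC :=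
  match k with
  | O => sconst C0
  | S k => sadd (sconst C1) (smul q (geometric_sum q k))
  end.

(** Neumann series: if [M] bounds [G], then [q = 1 - G/M] has norm at most [1 - c/M < 1], and the
    partial sums of the powers of [q] converge uniformly to [M/G], which lies in [A] because [A] is
    closed. *)
Lemma anqie_inverse A G c : anqie A -> A G -> 0 < c ->
  (forall n, Im (G n) = 0) -> (forall n, c <= Re (G n)) ->
  A (fun n => mkC (/ Re (G n)) 0).
Proof.
intros HA HG Hc Him Hre.
destruct (anqie_bounded A HA G HG) as [M HM].
assert (HRM : forall n, Re (G n) <= M).
{ intros n. eapply Rle_trans; [apply Rle_abs|].
  eapply Rle_trans; [apply Re_le_Cnorm | apply HM]. }
assert (HcM : c <= M) by (eapply Rle_trans; [apply (Hre 0%nat) | apply HRM]).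
set (q := sadd (sconst C1) (sscal (mkC (- / M) 0) G)).
assert (Hq : A q).
{ apply (anqie_add A HA); auto; try apply (anqie_const A _ HA). now apply (anqie_scal A HA). }
assert (Eq : forall n, q n = mkC (1 - Re (G n) / M) 0).
{ intros n. unfold q, sadd, sscal, sconst, Cadd, Cmul, C1; simpl.
  rewrite (Him n). f_equal; field; lra. }
assert (div1 : forall x, x <= M -> x / M <= 1).
{ intros x Hx. apply (Rmult_le_reg_r M); [lra|]. unfold Rdiv.
  rewrite Rmult_assoc, Rinv_l; lra. }
set (th := 1 - c / M).
assert (Hth : 0 <= th < 1).
{ unfold th. assert (0 < c / M) by (apply Rdiv_lt_0_compat; lra).
  assert (c / M <= 1) by (apply div1; lra). lra. }
assert (Hqth : forall n, Cnorm (q n) <= th).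
{ intros n. rewrite Eq, Cnorm_real.
  assert (Re (G n) / M <= 1) by (apply div1; auto).
  assert (c / M <= Re (G n) / M).
  { apply Rmult_le_compat_r; auto. left; apply Rinv_0_lt_compat; lra. }
  rewrite Rabs_pos_eq; unfold th; lra. }
set (s := fun n => mkC (M / Re (G n)) 0).
assert (Ds : forall k n, Cdist (s n) (geometric_sum q k n) <= th ^ k * (M / c)).
{ induction k as [|k IH]; intros n.
  - simpl. unfold sconst.
    replace (Cadd (s n) (Copp C0)) with (s n) by ring.
    unfold s. rewrite Cnorm_real. specialize (Hre n).
    rewrite Rabs_pos_eq by (apply Rlt_le, Rdiv_lt_0_compat; lra).
    rewrite Rmult_1_l. apply Rmult_le_compat_l; [lra|]. apply Rinv_le_contravar; lra.
  (* Since [s = 1/(1 - q)] is fixed by [x -> 1 + q x], each further term shrinks the error by the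
     factor [th]. *)
  - assert (Es : s n = Cadd C1 (Cmul (q n) (s n))).
    { rewrite Eq. unfold s, Cadd, Cmul, C1; simpl. specialize (Hre n).
      f_equal; field; lra. }
    rewrite Es. simpl. unfold sadd, smul, sconst.
    replace (Cadd (Cadd C1 (Cmul (q n) (s n)))
                  (Copp (Cadd C1 (Cmul (q n) (geometric_sum q k n)))))
      with (Cmul (q n) (Cadd (s n) (Copp (geometric_sum q k n)))) by ring.
    rewrite Cnorm_mul, Rmult_assoc.
    apply Rmult_le_compat; auto using Cnorm_pos. }
assert (Ak : forall k, A (geometric_sum q k)).
{ induction k as [|k IH]; simpl; auto; try apply (anqie_const A _ HA).
  apply (anqie_add A HA); auto; try apply (anqie_const A _ HA). now apply (anqie_mul A HA). }
assert (As : A s).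
{ apply (anqie_closed A HA). intros eps He.
  assert (HMc : 0 < M / c) by (apply Rdiv_lt_0_compat; lra).
  destruct (pow_lt_1_zero th) with (y := eps / (M / c)) as [k Hk].
  - rewrite Rabs_pos_eq; lra.
  - apply Rdiv_lt_0_compat; lra.
  - exists (geometric_sum q k). split; auto. intros n.
    eapply Rle_trans; [apply Ds|]. specialize (Hk k (Nat.le_refl k)).
    rewrite Rabs_pos_eq in Hk by (apply pow_le; lra).
    replace eps with (eps / (M / c) * (M / c)) by (field; lra).
    apply Rmult_le_compat_r; lra. }
replace (fun n => mkC (/ Re (G n)) 0) with (sscal (mkC (/ M) 0) s).
- now apply (anqie_scal A HA).
- apply functional_extensionality; intros n. unfold sscal, s, Cmul; simpl.
  specialize (Hre n). f_equal; field; lra.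
Qed.

(** [G] is invertible in [A], and a character cannot vanish on an invertible element. *)
Lemma character_pos A rho G c : anqie A -> character A rho -> A G -> 0 < c ->
  (forall n, Im (G n) = 0) -> (forall n, c <= Re (G n)) -> rho G <> C0.
Proof.
intros HA (H1 & _ & _ & Hm & _) HG Hc Him Hre E.
pose proof (anqie_inverse A G c HA HG Hc Him Hre) as HI.
set (I := fun n => mkC (/ Re (G n)) 0) in *.
assert (EI : smul I G = sconst C1).
{ apply functional_extensionality; intros n.
  unfold smul, I, sconst, Cmul, C1; simpl. rewrite (Him n). specialize (Hre n).
  f_equal; field; lra. }
assert (E1 : rho (sconst C1) = C0) by (rewrite <- EI, Hm, E by auto; ring).
rewrite H1 in E1. injection E1; lra.
Qed.

(* Otherwise the sum of the |g - rho g|^2 over g in l is bounded below, hence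
   invertible in A, although it lies in the kernel of rho. *)
Lemma evaluations_dense A rho l eps : anqie A -> character A rho ->
  (forall g, In g l -> A g) -> 0 < eps ->
  exists m, forall g, In g l -> Cdist (g m) (rho g) < eps.
Proof.
intros HA Hrho Hl He. apply NNPP. intros Hn.
assert (exists G, A G /\ rho G = C0 /\ forall m, Im (G m) = 0 /\ 0 <= Re (G m) /\
   forall g, In g l -> Cdist (g m) (rho g) * Cdist (g m) (rho g) <= Re (G m))
  as (G & HG & E & B).
{ clear Hn. pose proof Hrho as (_ & Ha & _ & Hm & _).
  induction l as [|g l IH].
  - exists (sconst C0). split; [apply (anqie_const A _ HA)|].
    split; [apply (character_const A); auto|].
    intros m. split; [easy|]. split; [simpl; lra | intros g []].
  - destruct IH as (G & HG & E & B); [intros; apply Hl; simpl; auto|].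
    assert (Ag : A g) by (apply Hl; simpl; auto).
    (* [rho] vanishes on [d], hence on [d] times its conjugate, whose value at [m] is the squared
       distance. *)
    set (d := sadd g (sconst (Copp (rho g)))).
    assert (Ad : A d) by (apply (anqie_add A HA); auto; try apply (anqie_const A _ HA)).
    assert (Ac : A (sconj d)) by now apply (anqie_conj A HA).
    exists (sadd G (smul d (sconj d))). split; [|split].
    + apply (anqie_add A HA); auto. now apply (anqie_mul A HA).
    + rewrite Ha, Hm, E by (auto; now apply (anqie_mul A HA)).
      unfold d at 1. rewrite Ha, (character_const A) by (auto; try apply (anqie_const A _ HA)).
      ring.
    + intros m. destruct (B m) as (B1 & B2 & B3).
      assert (ER : Re (smul d (sconj d) m) = Cdist (g m) (rho g) * Cdist (g m) (rho g)).
      { rewrite Cnorm_sqr. unfold smul, d, sadd, sconj, sconst; simpl. ring. }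
      pose proof (Cnorm_pos (Cadd (g m) (Copp (rho g)))).
      change (Re (sadd G (smul d (sconj d)) m))
        with (Re (G m) + Re (smul d (sconj d) m)).
      rewrite ER. split; [|split].
      * change (Im (G m) + Im (smul d (sconj d) m) = 0). rewrite B1.
        unfold smul, sconj; simpl. ring.
      * nra.
      * intros h [<-|Hh]; [lra|]. specialize (B3 h Hh). nra. }
apply (character_pos A rho G (eps * eps)); auto; [nra | apply B|].
intros m. destruct (B m) as (_ & _ & B3).
apply Rnot_lt_le. intros Hlt. apply Hn. exists m. intros g Hg.
specialize (B3 g Hg). pose proof (Cnorm_pos (Cadd (g m) (Copp (rho g)))).
apply Rnot_le_lt. intros Hge. nra.
Qed.

(** * The shift acting on characters *)

Lemma anqie_iter_shift A i g : anqie A -> A g -> A (Nat.iter i shift g).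
Proof. intros HA Hg. induction i as [|i IH]; simpl; auto. now apply (anqie_shift A HA). Qed.

Lemma iter_shift i g m : Nat.iter i shift g m = g (m + i)%nat.
Proof.
revert m. induction i as [|i IH]; intros m; simpl.
- f_equal; lia.
- unfold shift at 1. rewrite IH. f_equal; lia.
Qed.

Lemma Tshift_character A rho : anqie A -> character A rho -> character A (Tshift A rho).
Proof.
intros HA (H1 & Ha & Hs & Hm & H0).
assert (T : forall f, A f -> Tshift A rho f = rho (shift f)).
{ intros f Hf. unfold Tshift. now destruct excluded_middle_informative. }
repeat split.
- rewrite T by now apply (anqie_unit A HA). exact H1.
- intros f g Hf Hg. rewrite !T by (auto; now apply (anqie_add A HA)).
  apply (Ha (shift f) (shift g)); now apply (anqie_shift A HA).
- intros c f Hf. rewrite !T by (auto; now apply (anqie_scal A HA)).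
  apply (Hs c (shift f)); now apply (anqie_shift A HA).
- intros f g Hf Hg. rewrite !T by (auto; now apply (anqie_mul A HA)).
  apply (Hm (shift f) (shift g)); now apply (anqie_shift A HA).
- intros f Hf. unfold Tshift. now destruct excluded_middle_informative.
Qed.

Lemma iter_Tshift_character A rho i : anqie A -> character A rho ->
  character A (Nat.iter i (Tshift A) rho).
Proof.
intros HA Hr. induction i as [|i IH]; simpl; auto. now apply Tshift_character.
Qed.

Lemma iter_Tshift A rho i g : anqie A -> A g ->
  Nat.iter i (Tshift A) rho g = rho (Nat.iter i shift g).
Proof.
intros HA. revert g. induction i as [|i IH]; intros g Hg; [easy|].
rewrite (Nat.iter_succ_r i _ shift g).
change (Tshift A (Nat.iter i (Tshift A) rho) g = rho (Nat.iter i shift (shift g))).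
unfold Tshift at 1.
destruct excluded_middle_informative as [|N]; [|easy].
apply IH. now apply (anqie_shift A HA).
Qed.

(** * Compactness *)

(** The limit is the supremum of the thresholds [x] such that [u] is at least [x] on a set of
    [W]. *)
Lemma ultrafilter_limit_R (W : (nat -> Prop) -> Prop) (u : nat -> R) (M : R) :
  filter.UltraFilter W -> (forall m, Rabs (u m) <= M) ->
  exists c, forall eps, 0 < eps -> W (fun m => Rabs (u m - c) < eps).
Proof.
intros UW HM.
pose proof (@filter.ultra_proper _ _ UW) as PW.
pose proof (@filter.filter_filter _ _ PW) as FW.
set (E := fun x => W (fun m => x <= u m)).
assert (Em : forall m, - M <= u m <= M).
{ intros m. specialize (HM m). unfold Rabs in HM. destruct Rcase_abs; lra. }
destruct (completeness E) as [c [Hub Hlub]].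
- exists M. intros x Hx. apply Rnot_lt_le. intros Hlt.
  apply (@filter.filter_not_empty _ _ PW).
  apply (@filter.filterS _ _ FW _ _) with (2 := Hx).
  intros m Hm. destruct (Em m). simpl in Hm. exfalso. lra.
- exists (- M). apply (@filter.filterS _ _ FW _ _) with (2 := @filter.filterT _ _ FW).
  intros m _. apply Em.
- exists c. intros eps He.
  assert (L : W (fun m => c - eps / 2 <= u m)).
  { apply NNPP. intros Hn.
    assert (c <= c - eps / 2); [|lra].
    apply Hlub. intros x Hx. apply Rnot_lt_le. intros Hlt. apply Hn.
    apply (@filter.filterS _ _ FW _ _) with (2 := Hx). intros m Hm. simpl in Hm. lra. }
  assert (N : ~ W (fun m => c + eps / 2 <= u m)).
  { intros Hx. specialize (Hub _ Hx). lra. }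
  destruct (@filter.in_ultra_setVsetC _ _ (fun m => c + eps / 2 <= u m) UW) as [Y|Y];
    [easy|].
  apply (@filter.filterS _ _ FW _ _) with (2 := @filter.filterI _ _ FW _ _ L Y).
  intros m [H1 H2]. apply Rnot_le_lt in H2. apply Rabs_def1; lra.
Qed.

Lemma ultrafilter_limit (W : (nat -> Prop) -> Prop) (f : seqC) :
  filter.UltraFilter W -> bounded f ->
  exists c, forall eps, 0 < eps -> W (fun m => Cdist (f m) c < eps).
Proof.
intros UW [M HM].
pose proof (@filter.filter_filter _ _ (@filter.ultra_proper _ _ UW)) as FW.
destruct (ultrafilter_limit_R W (fun m => Re (f m)) M UW) as [a Ha].
{ intros m. eapply Rle_trans; [apply Re_le_Cnorm | apply HM]. }
destruct (ultrafilter_limit_R W (fun m => Im (f m)) M UW) as [b Hb].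
{ intros m. eapply Rle_trans; [apply Im_le_Cnorm | apply HM]. }
exists (mkC a b). intros eps He.
apply (@filter.filterS _ _ FW _ _)
  with (2 := @filter.filterI _ _ FW _ _ (Ha (eps / 2) ltac:(lra)) (Hb (eps / 2) ltac:(lra))).
intros m [H1 H2]. eapply Rle_lt_trans; [apply Cnorm_le_Re_Im|]. simpl in *.
unfold Rminus in H1, H2. lra.
Qed.

(* A filter base of conditions on positions has a character as cluster point:
   take the limit along an ultrafilter refining it. *)
Lemma cluster_character (A : seqC -> Prop) (P : list seqC -> R -> nat -> Prop) :
  anqie A ->
  (forall l l' e e' m, incl l l' -> e' <= e -> P l' e' m -> P l e m) ->
  (forall l e, (forall f, In f l -> A f) -> 0 < e -> exists m, P l e m) ->
  exists rho, character A rho /\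
    forall l e, (forall f, In f l -> A f) -> 0 < e ->
      exists m, P l e m /\ forall g, In g l -> Cdist (g m) (rho g) < e.
Proof.
intros HA anti ne.
(* The filter generated by the conditions [P l e]; concatenating lists and taking the smaller
   tolerance gives intersections. *)
set (F := fun B : nat -> Prop => exists l e, (forall f, In f l -> A f) /\ 0 < e /\
            forall m, P l e m -> B m).
assert (PF : filter.ProperFilter F).
{ constructor; [|constructor].
  - intros (l & e & Hl & He & H). destruct (ne l e Hl He) as [m Hm]. exact (H m Hm).
  - exists nil, 1. split; [intros f []|]. split; [lra|]. intros; exact Logic.I.
  - intros B B' (l & e & Hl & He & H) (l' & e' & Hl' & He' & H').
    exists (l ++ l'), (Rmin e e'). split; [|split].
    + intros f Hf. apply in_app_or in Hf. destruct Hf; auto.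
    + now apply Rmin_glb_lt.
    + intros m Hm. split.
      * apply H. apply (anti _ _ _ _ _ (incl_appl l' (incl_refl l)) (Rmin_l e e') Hm).
      * apply H'. apply (anti _ _ _ _ _ (incl_appr l (incl_refl l')) (Rmin_r e e') Hm).
  - intros B B' S (l & e & Hl & He & H). exists l, e.
    split; [exact Hl|]. split; [exact He|]. intros m Hm. exact (S m (H m Hm)). }
destruct (@filter.ultraFilterLemma _ F PF) as (W & UW & SW).
pose proof (@filter.ultra_proper _ _ UW) as PW.
pose proof (@filter.filter_filter _ _ PW) as FW.
assert (meet : forall B, W B -> exists m, B m).
{ intros B HB. apply NNPP. intros Hn. apply (@filter.filter_not_empty _ _ PW).
  apply (@filter.filterS _ _ FW _ _) with (2 := HB). intros m Hm. apply Hn. now exists m. }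
destruct (choice (fun (g : seqC) (c : C) =>
  (A g -> forall eps, 0 < eps -> W (fun m => Cdist (g m) c < eps)) /\
  (~ A g -> c = C0))) as [rho Hrho].
{ intros g. destruct (excluded_middle_informative (A g)) as [Hg|Hg].
  - destruct (ultrafilter_limit W g UW (anqie_bounded A HA g Hg)) as [c Hc].
    exists c. split; [auto | easy].
  - exists C0. split; [easy | auto]. }
assert (lim : forall g, A g -> forall eps, 0 < eps -> W (fun m => Cdist (g m) (rho g) < eps))
  by (intros g; apply Hrho).
assert (near : forall l, (forall g, In g l -> A g) -> forall eps, 0 < eps ->
   W (fun m => forall g, In g l -> Cdist (g m) (rho g) < eps)).
{ induction l as [|g l IH]; intros Hl eps He.
  - apply (@filter.filterS _ _ FW _ _) with (2 := @filter.filterT _ _ FW). intros m _ g [].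
  - apply (@filter.filterS _ _ FW _ _) with (2 := @filter.filterI _ _ FW _ _
      (lim g (Hl g (or_introl eq_refl)) eps He) (IH (fun h Hh => Hl h (or_intror Hh)) eps He)).
    intros m [H1 H2] h [<-|Hh]; auto. }
assert (equal : forall z w, (forall eps, 0 < eps -> Cdist z w <= eps) -> z = w).
{ intros z w H. apply Cdist_eq0. apply Rnot_lt_le. intros Hlt.
  specialize (H (Cdist z w / 2)). lra. }
(* Each identity holds exactly at every position. A position where all functions involved are close
   to their limits carries it over to [rho] up to [eps]. *)
assert (char : character A rho).
{ split; [|split; [|split; [|split]]].
  - apply equal. intros eps He.
    destruct (meet _ (lim _ (anqie_unit A HA) eps He)) as [m Hm].
    rewrite Cdist_sym. unfold sconst at 1 in Hm. lra.
  - intros f g Hf Hg. apply equal. intros eps He.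
    destruct (meet _ (near (f :: g :: sadd f g :: nil)
      ltac:(intros h [<-|[<-|[<-|[]]]]; auto; now apply (anqie_add A HA)) (eps / 3) ltac:(lra)))
      as [m Hm].
    pose proof (Hm f ltac:(simpl; auto)). pose proof (Hm g ltac:(simpl; auto)).
    pose proof (Hm (sadd f g) ltac:(simpl; auto)) as H3. rewrite Cdist_sym in H3.
    pose proof (Cdist_triangle (rho (sadd f g)) (sadd f g m) (Cadd (rho f) (rho g))).
    pose proof (Cdist_add (f m) (g m) (rho f) (rho g)).
    change (sadd f g m) with (Cadd (f m) (g m)) in *. lra.
  - intros c f Hf. apply equal. intros eps He. pose proof (Cnorm_pos c).
    set (e := eps / (Cnorm c + 2)).
    assert (0 < e) by (apply Rdiv_lt_0_compat; lra).
    assert (Ee : eps = (Cnorm c + 2) * e) by (unfold e; field; lra).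
    destruct (meet _ (near (f :: sscal c f :: nil)
      ltac:(intros h [<-|[<-|[]]]; auto; now apply (anqie_scal A HA)) e ltac:(lra)))
      as [m Hm].
    pose proof (Hm f ltac:(simpl; auto)) as H3.
    pose proof (Hm (sscal c f) ltac:(simpl; auto)) as H4. rewrite Cdist_sym in H4.
    pose proof (Cdist_triangle (rho (sscal c f)) (sscal c f m) (Cmul c (rho f))) as H5.
    change (sscal c f m) with (Cmul c (f m)) in *. rewrite Cdist_scal in H5.
    pose proof (Cnorm_pos (Cadd (f m) (Copp (rho f)))). nra.
  - intros f g Hf Hg. apply equal. intros eps He.
    destruct (anqie_bounded A HA f Hf) as [M HM].
    pose proof (Cnorm_pos (rho g)).
    assert (0 <= M) by (eapply Rle_trans; [apply Cnorm_pos | apply (HM 0%nat)]).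
    set (e := eps / (M + Cnorm (rho g) + 2)).
    assert (0 < e) by (apply Rdiv_lt_0_compat; lra).
    assert (Ee : eps = (M + Cnorm (rho g) + 2) * e) by (unfold e; field; lra).
    destruct (meet _ (near (f :: g :: smul f g :: nil)
      ltac:(intros h [<-|[<-|[<-|[]]]]; auto; now apply (anqie_mul A HA)) e ltac:(lra)))
      as [m Hm].
    pose proof (Hm f ltac:(simpl; auto)) as Hf'. pose proof (Hm g ltac:(simpl; auto)) as Hg'.
    pose proof (Hm (smul f g) ltac:(simpl; auto)) as H3. rewrite Cdist_sym in H3.
    pose proof (Cdist_triangle (rho (smul f g)) (smul f g m) (Cmul (rho f) (rho g))) as H4.
    change (smul f g m) with (Cmul (f m) (g m)) in *.
    pose proof (Cdist_mul (f m) (g m) (rho f) (rho g)) as H5.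
    pose proof (HM m). pose proof (Cnorm_pos (f m)).
    pose proof (Cnorm_pos (Cadd (f m) (Copp (rho f)))).
    pose proof (Cnorm_pos (Cadd (g m) (Copp (rho g)))).
    assert (Cnorm (f m) * Cdist (g m) (rho g) <= M * e) by (apply Rmult_le_compat; lra).
    assert (Cnorm (rho g) * Cdist (f m) (rho f) <= Cnorm (rho g) * e)
      by (apply Rmult_le_compat; lra).
    nra.
  - intros f Hf. now apply Hrho. }
exists rho. split; auto. intros l e Hl He.
assert (WP : W (P l e)).
{ apply SW. exists l, e. auto. }
destruct (meet _ (@filter.filterI _ _ FW _ _ WP (near l Hl e He))) as [m [H1 H2]].
exists m. split; auto.
Qed.

(** Otherwise, for all [l] and [e], some position has an [(l, e)]-neighbourhood contained in no
    [U i]. Such positions cluster at a character, which lies in some [U i] together with a basic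
    neighbourhood, and this swallows a smaller neighbourhood of a nearby position. *)
Lemma lebesgue_number (A : seqC -> Prop) (I : Type) (U : I -> functional -> Prop) :
  anqie A -> open_cover A U ->
  exists l e, 0 < e /\ (forall f, In f l -> A f) /\
    forall m, exists i, forall sigma, character A sigma ->
      (forall g, In g l -> Cdist (sigma g) (g m) < e) -> U i sigma.
Proof.
intros HA [HU Hcov]. apply NNPP. intros Hn.
destruct (cluster_character A (fun l e m => forall i, exists sigma, character A sigma /\
    (forall g, In g l -> Cdist (sigma g) (g m) < e) /\ ~ U i sigma) HA)
  as (rho & Hrho & Hc).
- intros l l' e e' m Hl He H i. destruct (H i) as (s & Hs & Hd & HnU).
  exists s. split; auto. split; auto. intros g Hg. specialize (Hd g (Hl g Hg)). lra.
- intros l e Hl He. apply NNPP. intros Hm. apply Hn.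
  exists l, e. split; auto. split; auto.
  intros m. apply NNPP. intros Hi. apply Hm. exists m. intros i.
  apply NNPP. intros Hs. apply Hi. exists i. intros s Cs Ds.
  apply NNPP. intros HnU. apply Hs. now exists s.
- destruct (Hcov rho Hrho) as [i Hi].
  destruct (HU i rho Hi) as (_ & l & e & He & Hl & Hnb).
  destruct (Hc l (e / 2) Hl) as (m & Hm & Dm); [lra|].
  destruct (Hm i) as (s & Cs & Ds & HnU). apply HnU, Hnb; auto.
  intros g Hg. specialize (Ds g Hg). specialize (Dm g Hg).
  pose proof (Cdist_triangle (s g) (g m) (rho g)). lra.
Qed.

(** * Zero entropy and window complexity *)

Lemma anqie_gen_anqie f : bounded f -> anqie (anqie_gen f).
Proof.
intros Hf. constructor.
- intros g Hg. exact (Hg _ anqie_linf Hf).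
- intros A HA Af. now apply anqie_unit.
- intros g h Hg Hh A HA Af. apply (anqie_add A HA); [now apply Hg | now apply Hh].
- intros c g Hg A HA Af. apply (anqie_scal A HA). now apply Hg.
- intros g h Hg Hh A HA Af. apply (anqie_mul A HA); [now apply Hg | now apply Hh].
- intros g Hg A HA Af. apply (anqie_conj A HA). now apply Hg.
- intros g H A HA Af. apply (anqie_closed A HA). intros eps He.
  destruct (H eps He) as (h & Hh & D). exists h. split; auto. now apply Hh.
- intros g Hg A HA Af. apply (anqie_shift A HA). now apply Hg.
Qed.

(** One word per colour suffices. The orbit of a character is approximated along the window of some
    position [m], this window is close to that of the representative of its colour, and the Lebesgue
    number names a cover member for each position of the latter. *)
Lemma zero_entropy_of_low_complexity A :
  anqie A -> (forall f, A f -> low_complexity f) -> zero_entropy A.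
Proof.
intros HA low I U HU eps Heps.
destruct (lebesgue_number A I U HA HU) as (l & e & He & Hl & Hleb).
destruct (choice _ Hleb) as [idx Hidx].
destruct (jointly_low_all l (fun f Hf => low f (Hl f Hf)) (e / 4) eps)
  as [N0 HN0]; [lra | auto |].
exists N0. intros n Hn. destruct (HN0 n Hn) as (k & c & Bk & Lc & Wc).
exists k. split; auto.
(* A position of colour [j], or an arbitrary one if that colour does not occur. *)
destruct (choice (fun j m => forall m', c m' = j -> c m = j)) as [rep Hrep].
{ intros j. destruct (classic (exists m, c m = j)) as [[m Hm]|H].
  - now exists m.
  - exists 0%nat. intros m' Hm'. exfalso. apply H. now exists m'. }
exists (map (fun j i => idx (rep j + i)%nat) (seq 0 k)).
split; [rewrite length_map, length_seq; auto|].
intros rho Hrho.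
(* Including the shifts by all [i < n] lets one position follow [rho] along its first [n]
   iterates. *)
destruct (evaluations_dense A rho
  (flat_map (fun i => map (Nat.iter i shift) l) (seq 0 n)) (e / 4) HA Hrho)
  as [m Hm]; [|lra|].
{ intros g Hg. apply in_flat_map in Hg. destruct Hg as (i & _ & Hg).
  apply in_map_iff in Hg. destruct Hg as (h & <- & Hh). apply anqie_iter_shift; auto. }
exists (fun i => idx (rep (c m) + i)%nat). split.
- apply (in_map (fun j i => idx (rep j + i)%nat)), in_seq. specialize (Lc m). lia.
- split; auto. intros i Hi. apply Hidx; [now apply iter_Tshift_character|].
  intros g Hg. rewrite iter_Tshift by auto.
  assert (D : Cdist (Nat.iter i shift g m) (rho (Nat.iter i shift g)) < e / 4).
  { apply Hm. apply in_flat_map. exists i. split; [apply in_seq; lia|].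
    now apply in_map. }
  rewrite iter_shift in D. rewrite Cdist_sym in D.
  pose proof (Wc g Hg m (rep (c m)) (eq_sym (Hrep (c m) m eq_refl)) i Hi).
  pose proof (Cdist_triangle (rho (Nat.iter i shift g)) (g (m + i)%nat)
    (g (rep (c m) + i)%nat)). lra.
Qed.

(** The cover consists of the preimages under [rho -> rho f] of the discs of radius [eps / 2],
    indexed by their centres. A word of the join is then a list of centres, and a position is
    coloured by the index of a word whose set contains its evaluation. *)
Lemma low_complexity_of_zero_entropy A f :
  anqie A -> A f -> zero_entropy A -> low_complexity f.
Proof.
intros HA Hf H eps delta He Hd.
destruct (H C (fun z rho => character A rho /\ Cdist (rho f) z < eps / 2)) with (eps := delta)
  as [N0 HN0]; auto.
- split.
  + intros z rho [Hrho D]. split; auto.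
    exists (f :: nil), (eps / 2 - Cdist (rho f) z). split; [lra|].
    split; [intros g [<-|[]]; auto|].
    intros s Hs Ds. split; auto. specialize (Ds f ltac:(simpl; auto)).
    pose proof (Cdist_triangle (s f) (rho f) z). lra.
  + intros rho Hrho. exists (rho f). split; auto. rewrite Cdist_refl. lra.
- exists N0. intros n Hn. destruct (HN0 n Hn) as (k & (ws & Lws & Hws) & Bk).
  destruct (choice (fun m j => (j < k)%nat /\ forall i, (i < n)%nat ->
      Cdist (f (m + i)%nat) (nth j ws (fun _ => C0) i) < eps / 2)) as [c Hc].
  { intros m. destruct (Hws _ (evaluation_character A m HA)) as (w & Hw & _ & J).
    destruct (In_nth ws w (fun _ => C0) Hw) as (j & Hj & E).
    exists j. split; [lia|]. intros i Hi. destruct (J i Hi) as [_ D].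
    rewrite iter_Tshift, evaluation_in, iter_shift in D
      by (auto; now apply anqie_iter_shift).
    now rewrite E. }
  exists k, c. split; auto. split; [intros m; apply Hc|].
  intros g [<-|[]] m m' E i Hi.
  pose proof (proj2 (Hc m) i Hi). pose proof (proj2 (Hc m') i Hi) as D'.
  rewrite Cdist_sym, <- E in D'.
  pose proof (Cdist_triangle (f (m + i)%nat) (nth (c m) ws (fun _ => C0) i)
    (f (m' + i)%nat)). lra.
Qed.

Lemma E0_low_complexity : E0 = (fun f => bounded f /\ low_complexity f).
Proof.
apply functional_extensionality. intros f. apply propositional_extensionality.
unfold E0. split; intros [Bf H]; split; auto; pose proof (anqie_gen_anqie f Bf) as Hg.
- apply (low_complexity_of_zero_entropy (anqie_gen f)); auto. now intros A _ Af.
- apply zero_entropy_of_low_complexity; auto.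
  intros g Gg. exact (proj2 (Gg _ anqie_low_complexity (conj Bf H))).
Qed.

Lemma anqie_E0 : anqie E0.
Proof. rewrite E0_low_complexity. exact anqie_low_complexity. Qed.

(** * Separation by clopen sets *)

(** Exact equality of blocks, in any type, survives composition with an arbitrary function, even a
    discontinuous one such as the test for lying in a disc. *)
Definition few_aligned_blocks {T : Type} (u : nat -> T) : Prop :=
  forall delta, 0 < delta -> exists n K e, (0 < n)%nat /\
    INR K <= exp (delta * INR n) /\ (forall a, (e a < K)%nat) /\
    forall a a', e a = e a' -> forall i, (i < n)%nat ->
      u (a * n + i)%nat = u (a' * n + i)%nat.

(** The number with base-[K] digits [e a, e (a+1), ..., e (a+t-1)], least significant first. *)
Fixpoint word_code (e : nat -> nat) (K t a : nat) : nat :=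
  match t with
  | O => 0
  | S t => K * word_code e K t (S a) + e a
  end.

Lemma word_code_lt e K t a : (forall a, (e a < K)%nat) -> (word_code e K t a < K ^ t)%nat.
Proof.
intros He. revert a. induction t as [|t IH]; intros a; simpl; [lia|].
specialize (IH (S a)). specialize (He a). nia.
Qed.

Lemma word_code_inj e K t a a' : (forall a, (e a < K)%nat) ->
  word_code e K t a = word_code e K t a' ->
  forall j, (j < t)%nat -> e (a + j)%nat = e (a' + j)%nat.
Proof.
intros He. revert a a'. induction t as [|t IH]; intros a a' E j Hj; [lia|].
simpl in E. destruct (Nat.div_mod_unique K _ _ _ _ (He a) (He a') E) as [E1 E2].
destruct j as [|j]; [now rewrite !Nat.add_0_r|].
rewrite <- !Nat.add_succ_comm. apply IH; auto; lia.
Qed.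

Lemma exp_pow x t : exp x ^ t = exp (INR t * x).
Proof.
induction t as [|t IH]; [simpl; now rewrite Rmult_0_l, exp_0|].
rewrite S_INR. simpl pow. rewrite IH, <- exp_plus. f_equal; ring.
Qed.

(** A window of length [L] at [m] is determined by [m mod n] and the labels of [L / n + 2]
    consecutive aligned blocks, the 2 allowing for partial blocks at the ends. This gives
    [n * K ^ t] colours. *)
Lemma low_complexity_aligned u : few_aligned_blocks u -> low_complexity u.
Proof.
intros H eps delta Heps Hd.
destruct (H (delta / 2)) as (n & K & e & Hn & BK & He & Hu); [lra|].
(* For such [L], the overhead [n + delta * n] in the exponent is at most [delta / 2 * L]. *)
destruct (INR_unbounded (2 * (INR n + delta * INR n) / delta)) as [N0 HN0].
exists N0. intros L HL. set (t := (L / n + 2)%nat).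
exists (n * K ^ t)%nat, (fun m => (n * word_code e K t (m / n) + m mod n)%nat).
split; [|split].
- assert (BL : 2 * (INR n + delta * INR n) <= delta * INR L).
  { apply le_INR in HL.
    replace (2 * (INR n + delta * INR n))
      with (delta * (2 * (INR n + delta * INR n) / delta)) by (field; lra).
    apply Rmult_le_compat_l; lra. }
  assert (Bt : INR t * INR n <= INR L + 2 * INR n).
  { replace 2 with (INR 2) by easy. rewrite <- !mult_INR, <- plus_INR.
    apply le_INR. unfold t. pose proof (Nat.Div0.mul_div_le L n). nia. }
  rewrite mult_INR, pow_INR.
  apply Rle_trans with (exp (INR n) * exp (delta / 2 * INR n) ^ t).
  + apply Rmult_le_compat; auto using pos_INR.
    * apply pow_le, pos_INR.
    * pose proof (exp_ineq1_le (INR n)). lra.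
    * apply pow_incr. split; auto using pos_INR.
  + rewrite exp_pow, <- exp_plus.
    assert (INR n + INR t * (delta / 2 * INR n) <= delta * INR L) as [B|B]
      by nra; [left; now apply exp_increasing | right; now rewrite B].
- intros m. pose proof (word_code_lt e K t (m / n) He).
  pose proof (Nat.mod_upper_bound m n). nia.
- intros g [<-|[]] m m' E i Hi.
  destruct (Nat.div_mod_unique n _ _ _ _ (Nat.mod_upper_bound m n ltac:(lia))
    (Nat.mod_upper_bound m' n ltac:(lia)) E) as [E1 E2].
  set (s := (m mod n + i)%nat).
  assert (Hs : (s / n < t)%nat).
  { apply Nat.Div0.div_lt_upper_bound. unfold s, t.
    pose proof (Nat.mod_upper_bound m n). pose proof (Nat.div_mod_eq L n).
    pose proof (Nat.mod_upper_bound L n). nia. }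
  assert (D : forall x, x mod n = m mod n ->
    (x + i = (x / n + s / n) * n + s mod n)%nat).
  { intros x Hx. pose proof (Nat.div_mod_eq x n). pose proof (Nat.div_mod_eq s n).
    unfold s in *. lia. }
  rewrite (D m eq_refl), (D m' (eq_sym E2)).
  rewrite (Hu _ _ (word_code_inj e K t _ _ He E1 (s / n) Hs)).
  + rewrite Cdist_refl. lra.
  + apply Nat.mod_upper_bound. lia.
Qed.

(** * Replacing aligned blocks by representatives at all scales *)

Definition block_map (rep : nat -> nat) (n m : nat) : nat := (rep (m / n) * n + m mod n)%nat.

Lemma block_map_eq rep n a i : (i < n)%nat ->
  block_map rep n (a * n + i) = (rep a * n + i)%nat.
Proof.
intros Hi. unfold block_map.
rewrite Nat.div_add_l, (Nat.div_small i) by lia.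
now rewrite Nat.add_0_r, Nat.add_comm, (Nat.add_comm (a * n)), Nat.Div0.mod_add,
  Nat.mod_small, Nat.add_comm.
Qed.

(** The [n]-block [a] is number [a mod q] within the coarse block [a / q], and it keeps that place
    when the coarse block is replaced. *)
Lemma block_map_divisor rep n q a : (0 < q)%nat -> exists b, forall i, (i < n)%nat ->
  block_map rep (n * q) (a * n + i) = (b * n + i)%nat.
Proof.
intros Hq. exists (rep (a / q) * q + a mod q)%nat. intros i Hi.
pose proof (Nat.mod_upper_bound a q ltac:(lia)).
replace (a * n + i)%nat with ((a / q) * (n * q) + ((a mod q) * n + i))%nat.
- rewrite block_map_eq by nia. nia.
- pose proof (Nat.div_mod_eq a q) as E. rewrite E at 3. nia.
Qed.

Lemma coloring_representative (c : nat -> nat) : exists rep,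
  rep 0%nat = 0%nat /\ (forall a, c (rep a) = c a) /\
  (forall a a', c a = c a' -> rep a = rep a').
Proof.
destruct (choice (fun j m => forall m', c m' = j -> c m = j)) as [r Hr].
{ intros j. destruct (classic (exists m, c m = j)) as [[m Hm]|H].
  - now exists m.
  - exists 0%nat. intros m' Hm'. exfalso. apply H. now exists m'. }
(* The class of 0 must be represented by 0 itself, so that the first block stays fixed. *)
exists (fun a => if Nat.eqb (c a) (c 0%nat) then 0%nat else r (c a)).
split; [now rewrite Nat.eqb_refl|]. split.
- intros a. destruct (Nat.eqb_spec (c a) (c 0%nat)) as [E|]; auto.
  now apply (Hr (c a) a).
- intros a a' E. now rewrite E.
Qed.

(** The factor [N0 k + 2] at least doubles the scale, which therefore exceeds [k], and it also
    brings the scale above the threshold [N0 k]. *)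
Fixpoint scale (N0 : nat -> nat) (k : nat) : nat :=
  match k with
  | O => S (N0 0%nat)
  | S k' => scale N0 k' * (N0 k + 2)
  end.

Lemma scale_gt N0 k : (k < scale N0 k)%nat /\ (N0 k <= scale N0 k)%nat.
Proof. induction k as [|k IH]; simpl; nia. Qed.

Lemma scale_divides N0 k j : exists q, (0 < q)%nat /\ scale N0 (k + j) = (scale N0 k * q)%nat.
Proof.
induction j as [|j (q & Hq & E)].
- exists 1%nat. rewrite Nat.add_0_r. lia.
- exists (q * (N0 (S (k + j)) + 2))%nat. rewrite (Nat.add_succ_r k j).
  change (scale N0 (S (k + j))) with (scale N0 (k + j) * (N0 (S (k + j)) + 2))%nat.
  rewrite E.
  split; nia.
Qed.

(** The composite of [psi 0, ..., psi (k-1)] in which [psi (k-1)] is applied first. *)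
Fixpoint compose_upto (psi : nat -> nat -> nat) (k m : nat) : nat :=
  match k with
  | O => m
  | S k => compose_upto psi k (psi k m)
  end.

Lemma compose_upto_stable psi k m : (forall j, (m <= j)%nat -> psi j m = m) ->
  (m <= k)%nat -> compose_upto psi k m = compose_upto psi m m.
Proof.
intros H. induction 1 as [|k Hk IH]; [easy|]. simpl. now rewrite H.
Qed.

(* At every scale n_k (with n_k dividing n_{k+1}) aligned n_k-blocks of f are
   replaced by representatives, the coarsest scale first.  Coarser replacements
   translate aligned n_k-blocks to aligned n_k-blocks, so the number of n_k-blocks
   of the result is governed by the number of representatives at scale k alone.
   As block 0 represents itself, the infinite composition is locally finite. *)
Lemma quantization f eps : low_complexity f -> 0 < eps ->
  exists H : nat -> nat, few_aligned_blocks H /\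
    forall m, Cdist (f (H m)) (f m) <= eps.
Proof.
intros low Heps.
assert (half : forall k, 0 < (/ 2) ^ k) by (intros k; apply pow_lt; lra).
(* The tolerances [eps / 2^(k+1)] add up to at most [eps], while the rates [1 / (k+1)] tend to 0. *)
destruct (choice (fun k N0 => forall n, (N0 <= n)%nat -> exists K c,
  INR K <= exp (/ INR (S k) * INR n) /\ (forall m, (c m < K)%nat) /\
  window_coloring f n (eps * (/ 2) ^ S k) c)) as [N0 HN0].
{ intros k. destruct (low (eps * (/ 2) ^ S k) (/ INR (S k))) as [N0 HN].
  - apply Rmult_lt_0_compat; auto.
  - apply Rinv_0_lt_compat, lt_0_INR. lia.
  - exists N0. intros n Hn. destruct (HN n Hn) as (K & c & B & L & W).
    exists K, c. split; auto. split; auto. apply W. simpl; auto. }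
set (n := scale N0).
assert (npos : forall k, (k < n k)%nat) by apply scale_gt.
destruct (choice (fun k rep => rep 0%nat = 0%nat /\
  (forall a i, (i < n k)%nat ->
     Cdist (f (rep a * n k + i)%nat) (f (a * n k + i)%nat) <= eps * (/ 2) ^ S k) /\
  exists K e, INR K <= exp (/ INR (S k) * INR (n k)) /\ (forall a, (e a < K)%nat) /\
    forall a a' : nat, e a = e a' -> rep a = rep a' :> nat)) as [rep Hrep].
{ intros k. destruct (HN0 k (n k)) as (K & c & B & L & W); [apply scale_gt|].
  destruct (coloring_representative (fun a => c (a * n k)%nat)) as (rep & R0 & Rc & Re).
  exists rep. split; auto. split.
  - intros a i Hi. now apply W.
  - now exists K, (fun a => c (a * n k)%nat). }
set (psi := fun k => block_map (rep k) (n k)).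
assert (psi_small : forall k m, (m < n k)%nat -> psi k m = m).
{ intros k m Hm. change m with (0 * n k + m)%nat at 1. unfold psi.
  rewrite block_map_eq by auto. now rewrite (proj1 (Hrep k)). }
assert (psi_close : forall k m, Cdist (f (psi k m)) (f m) <= eps * (/ 2) ^ S k).
{ intros k m.
  assert (E : m = (m / n k * n k + m mod n k)%nat)
    by (pose proof (Nat.div_mod_eq m (n k)); lia).
  rewrite E at 2. apply (Hrep k). apply Nat.mod_upper_bound. specialize (npos k). lia. }
(* Since [m < n j] for [j >= m], all these [psi j] fix [m], and stopping at index [m] gives the
   infinite composition. *)
exists (fun m => compose_upto psi m m). split.
- intros delta Hd. destruct (INR_unbounded (/ delta)) as [k Hk].
  destruct (Hrep k) as (_ & _ & K & e & BK & LK & HK).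
  (* The maps of index above [k] carry block [a] to some block [b], and [psi k] carries that to
     block [rep k b]; the remaining maps see only the latter. *)
  assert (Hblock : forall j a, exists b, forall i, (i < n k)%nat ->
    compose_upto psi (S k + j) (a * n k + i)
      = compose_upto psi k (rep k b * n k + i)).
  { induction j as [|j IH]; intros a.
    - exists a. intros i Hi. rewrite Nat.add_0_r. simpl. unfold psi at 2.
      now rewrite block_map_eq.
    - destruct (scale_divides N0 k (S j)) as (q & Hq & Eq).
      destruct (block_map_divisor (rep (S k + j)%nat) (n k) q a Hq) as [a' Ha'].
      destruct (IH a') as [b Hb]. exists b. intros i Hi.
      rewrite <- Hb by auto. rewrite (Nat.add_succ_r (S k) j).
      change (compose_upto psi (S k + j) (psi (S k + j)%nat (a * n k + i)%nat)
        = compose_upto psi (S k + j) (a' * n k + i)).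
      rewrite <- Ha' by auto. unfold psi at 2. f_equal. f_equal.
      change (scale N0 (S k + j) = scale N0 k * q)%nat. rewrite <- Eq. f_equal. lia. }
  destruct (choice (fun a b => forall i, (i < n k)%nat ->
    compose_upto psi (a * n k + i) (a * n k + i)
      = compose_upto psi k (rep k b * n k + i))) as [b Hb].
  (* This index exceeds every position of block [a], so the composition is already stable there. *)
  { intros a. destruct (Hblock (S a * n k)%nat a) as [b Hb]. exists b. intros i Hi.
    rewrite <- Hb by auto. symmetry. apply compose_upto_stable.
    - intros j Hj. apply psi_small. specialize (npos j). lia.
    - simpl. lia. }
  exists (n k), K, (fun a => e (b a)). split; [specialize (npos k); lia|].
  split; [|split; auto].
  + eapply Rle_trans; [exact BK|].
    assert (/ INR (S k) <= delta).
    { rewrite <- (Rinv_inv delta). rewrite S_INR.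
      apply Rinv_le_contravar; [now apply Rinv_0_lt_compat | lra]. }
    assert (/ INR (S k) * INR (n k) <= delta * INR (n k)) as [B|B]
      by (apply Rmult_le_compat_r; auto using pos_INR);
      [left; now apply exp_increasing | right; now rewrite B].
  + intros a a' E i Hi. rewrite !Hb by auto. now rewrite (HK _ _ E).
- assert (close : forall k m, Cdist (f (compose_upto psi k m)) (f m) <= eps * (1 - (/ 2) ^ k)).
  { induction k as [|k IH]; intros m; simpl compose_upto.
    - rewrite Cdist_refl. simpl. lra.
    - pose proof (Cdist_triangle (f (compose_upto psi k (psi k m))) (f (psi k m)) (f m)).
      specialize (IH (psi k m)). specialize (psi_close k m). simpl pow in *. nra. }
  intros m. eapply Rle_trans; [apply close|]. specialize (half m). nra.
Qed.

(** * Idempotents and the clopen sets they define *)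

Definition indicator (b : nat -> bool) : seqC := fun m => if b m then C1 else C0.

Lemma Cdist_C1_C0 : Cdist C1 C0 = 1.
Proof.
replace (Cadd C1 (Copp C0)) with (mkC 1 0).
- rewrite Cnorm_real. apply Rabs_R1.
- unfold Cadd, Copp, C1, C0; simpl; f_equal; ring.
Qed.

Lemma indicator_bounded b : bounded (indicator b).
Proof.
exists 1. intros m. unfold indicator.
replace 1 with (Cnorm (mkC 1 0)) by (rewrite Cnorm_real; apply Rabs_R1).
destruct (b m); [apply Rle_refl|]. unfold C0. rewrite !Cnorm_real, Rabs_R0, Rabs_R1. lra.
Qed.

Lemma E0_indicator b : few_aligned_blocks b -> E0 (indicator b).
Proof.
intros H. rewrite E0_low_complexity. split; [apply indicator_bounded|].
apply low_complexity_aligned. intros delta Hd.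
destruct (H delta Hd) as (n & K & e & Hn & BK & He & Hb).
exists n, K, e. repeat (split; [easy|]).
intros a a' E i Hi. unfold indicator. now rewrite (Hb a a' E i Hi).
Qed.

Lemma character_indicator A rho b : character A rho -> A (indicator b) ->
  rho (indicator b) = C0 \/ rho (indicator b) = C1.
Proof.
intros (_ & _ & _ & Hm & _) Hb.
assert (E : Cmul (rho (indicator b)) (rho (indicator b)) = rho (indicator b)).
{ rewrite <- Hm by auto. f_equal. apply functional_extensionality. intros m.
  unfold smul, indicator. destruct (b m); ring. }
set (z := rho (indicator b)) in *.
assert (N : Cdist z C0 * Cdist z C1 = 0).
{ rewrite <- Cnorm_mul.
  replace (Cmul (Cadd z (Copp C0)) (Cadd z (Copp C1)))
    with (Cadd (Cmul z z) (Copp z)) by ring.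
  rewrite E. apply Cdist_refl. }
apply Rmult_integral in N. destruct N; [left|right]; apply Cdist_eq0; lra.
Qed.

Lemma indicator_wclopen A b : A (indicator b) ->
  wclopen A (fun rho => character A rho /\ rho (indicator b) = C1).
Proof.
intros Hb. pose proof Cdist_C1_C0 as E.
assert (E' : Cdist C0 C1 = 1) by now rewrite Cdist_sym.
split; intros rho [Hrho H]; (split; [easy|]);
  exists (indicator b :: nil), (1 / 2); (split; [lra|]);
  (split; [intros f [<-|[]]; exact Hb|]);
  intros s Hs D; specialize (D (indicator b) ltac:(simpl; auto)).
- split; auto. rewrite H in D.
  destruct (character_indicator A s b Hs Hb) as [F|F]; auto. rewrite F in D. lra.
- split; auto. intros [_ F]. rewrite F in D.
  destruct (character_indicator A rho b Hrho Hb) as [G|G]; [|tauto].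
  rewrite G in D. lra.
Qed.

(** Let [d] be the distance of the two values at [f], and quantize [f] up to [d / 4]. At positions
    close to [rho], [f (H m)] is within [d/4 + d/4] of [rho f], so [b] holds; at positions close to
    [sigma], [b] would give [d < d/2 + d/4 + d/4]. *)
Lemma E0_totally_disconnected : totally_disconnected E0.
Proof.
intros rho sigma Hrho Hsigma Hne. pose proof anqie_E0 as HA.
assert (exists f, E0 f /\ rho f <> sigma f) as (f & Hf & Hfne).
{ apply NNPP. intros Hn. apply Hne. apply functional_extensionality. intros f.
  destruct (classic (E0 f)) as [Hf|Hf].
  - apply NNPP. intros Hd. apply Hn. now exists f.
  - destruct Hrho as (_ & _ & _ & _ & H0), Hsigma as (_ & _ & _ & _ & H0').
    now rewrite H0, H0'. }
set (d := Cdist (rho f) (sigma f)).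
assert (Hd : 0 < d).
{ apply Rnot_le_lt. intros Hle. now apply Hfne, Cdist_eq0. }
assert (low : low_complexity f) by (rewrite E0_low_complexity in Hf; tauto).
destruct (quantization f (d / 4) low) as (H & HH & Hclose); [lra|].
set (b := fun m => if Rlt_dec (Cdist (f (H m)) (rho f)) (d / 2) then true else false).
assert (Hb : E0 (indicator b)).
{ apply E0_indicator. intros delta Hdelta.
  destruct (HH delta Hdelta) as (n & K & e & Hn & BK & He & Hu).
  exists n, K, e. repeat (split; [easy|]).
  intros a a' E i Hi. unfold b. now rewrite (Hu a a' E i Hi). }
(* One position approximates [tau] at both functions; a distance below 1 decides the value of [tau]
   at the indicator. *)
assert (near : forall tau, character E0 tau -> exists m,
  Cdist (f m) (tau f) < d / 4 /\ Cdist (indicator b m) (tau (indicator b)) < 1).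
{ intros tau Ht.
  destruct (evaluations_dense E0 tau (f :: indicator b :: nil) (Rmin (d / 4) 1) HA Ht)
    as [m Hm].
  - intros g [<-|[<-|[]]]; auto.
  - apply Rmin_glb_lt; lra.
  - exists m. split.
    + eapply Rlt_le_trans; [apply (Hm f); simpl; auto | apply Rmin_l].
    + eapply Rlt_le_trans; [apply (Hm (indicator b)); simpl; auto | apply Rmin_r]. }
exists (fun tau => character E0 tau /\ tau (indicator b) = C1).
split; [now apply indicator_wclopen|]. split; [split; auto|intros [_ E]].
- destruct (near rho Hrho) as (m & D1 & D2).
  destruct (character_indicator E0 rho b Hrho Hb) as [E|]; auto. exfalso.
  rewrite E in D2. unfold indicator, b in D2. specialize (Hclose m).
  pose proof (Cdist_triangle (f (H m)) (f m) (rho f)).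
  destruct Rlt_dec; [rewrite Cdist_C1_C0 in D2; lra | lra].
- destruct (near sigma Hsigma) as (m & D1 & D2).
  rewrite E in D2. unfold indicator, b in D2. specialize (Hclose m).
  pose proof (Cdist_triangle (f (H m)) (f m) (sigma f)).
  pose proof (Cdist_triangle (rho f) (f (H m)) (sigma f)) as D3.
  rewrite (Cdist_sym (rho f) (f (H m))) in D3. fold d in D3.
  destruct Rlt_dec; [lra|]. rewrite Cdist_sym, Cdist_C1_C0 in D2. lra.
Qed.

(** * An open set whose closure is not open *)

(** Two labels suffice, one for the block containing [p] and one for the zero blocks;
    [2 <= exp (delta * n)] once [delta * n >= 1]. *)
Lemma E0_singleton p : E0 (indicator (Nat.eqb p)).
Proof.
apply E0_indicator. intros delta Hd.
destruct (INR_unbounded (/ delta)) as [n Hn].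
assert (Hdn : 1 <= delta * INR n).
{ rewrite <- (Rinv_r delta) by lra. apply Rmult_le_compat_l; lra. }
assert (Hn0 : (0 < n)%nat) by (destruct n; [simpl in Hdn; lra | lia]).
exists n, 2%nat, (fun a => if Nat.eqb a (p / n) then 1%nat else 0%nat).
split; [exact Hn0|]. split; [|split].
- pose proof (exp_ineq1_le (delta * INR n)). simpl INR. lra.
- intros a. destruct Nat.eqb; lia.
- assert (Hp : forall a i, (i < n)%nat -> a <> (p / n)%nat -> Nat.eqb p (a * n + i) = false).
  { intros a i Hi Ha. apply Nat.eqb_neq. intros ->. apply Ha.
    rewrite Nat.div_add_l, Nat.div_small; lia. }
  intros a a' E i Hi.
  destruct (Nat.eqb_spec a (p / n)), (Nat.eqb_spec a' (p / n)); try easy; [congruence|].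
  now rewrite !Hp.
Qed.

(** Let [e] be the indicator of [p]. As [g e = g(p) e] for every [g], a character with value 1 at
    [e] is the evaluation at [p], and the only other possible value at [e] is 0. *)
Lemma evaluation_isolated p : wopen E0 (fun rho => rho = evaluation E0 p).
Proof.
intros rho ->. pose proof anqie_E0 as HA. pose proof (E0_singleton p) as Hp.
split; [now apply evaluation_character|].
exists (indicator (Nat.eqb p) :: nil), (1 / 2). split; [lra|].
split; [intros f [<-|[]]; exact Hp|].
intros s Hs D. specialize (D _ (or_introl eq_refl)).
rewrite evaluation_in in D by exact Hp. unfold indicator at 2 in D.
rewrite Nat.eqb_refl in D.
destruct (character_indicator E0 s _ Hs Hp) as [E|E].
{ rewrite E, Cdist_sym, Cdist_C1_C0 in D. lra. }
destruct Hs as (_ & _ & Hsc & Hm & H0). apply functional_extensionality. intros g.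
destruct (classic (E0 g)) as [Hg|Hg].
- rewrite evaluation_in by auto.
  assert (F : smul g (indicator (Nat.eqb p)) = sscal (g p) (indicator (Nat.eqb p))).
  { apply functional_extensionality. intros m. unfold smul, sscal, indicator.
    destruct (Nat.eqb_spec p m) as [->|]; ring. }
  assert (G : s (smul g (indicator (Nat.eqb p))) = s (sscal (g p) (indicator (Nat.eqb p))))
    by now rewrite F.
  rewrite Hm, Hsc, E in G by auto.
  replace (s g) with (Cmul (s g) C1) by ring. rewrite G. ring.
- rewrite H0 by auto. unfold evaluation. now destruct excluded_middle_informative.
Qed.

(** If no finite list determined [b], pairs [m, m'] with close values but [b m] true and [b m']
    false would cluster at a character in the closure. Openness puts the evaluation at some such
    [m'] into the closure, and being isolated it belongs to the set itself, so [b m'] is true. *)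
Lemma low_complexity_of_open_closure (b : nat -> bool) :
  wopen E0 (wclosure E0 (fun rho => exists m, b m = true /\ rho = evaluation E0 m)) ->
  low_complexity (indicator b).
Proof.
intros Hopen. pose proof anqie_E0 as HA.
assert (exists l eta, 0 < eta /\ (forall f, In f l -> E0 f) /\
  forall m m', (forall f, In f l -> Cdist (f m) (f m') <= eta) -> b m = b m')
  as (l & eta & Heta & Hl & Hb).
2:{ apply low_complexity_dominated. intros eps He. exists l, eta. split; auto. split.
    - intros f Hf. specialize (Hl f Hf). rewrite E0_low_complexity in Hl. tauto.
    - intros m m' H. unfold indicator. rewrite (Hb m m' H), Cdist_refl. lra. }
apply NNPP. intros Hn.
destruct (cluster_character E0 (fun l e m => b m = true /\ exists m', b m' = false /\
   forall f, In f l -> Cdist (f m) (f m') <= e) HA) as (rho & Hrho & Hc).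
- intros l l' e e' m Hl He (Hm & m' & Hm' & D). split; auto. exists m'. split; auto.
  intros f Hf. specialize (D f (Hl f Hf)). lra.
- intros l e Hl He. apply NNPP. intros Hm. apply Hn. exists l, e.
  split; auto. split; auto. intros m m' D.
  destruct (b m) eqn:Bm, (b m') eqn:Bm'; auto; exfalso; apply Hm.
  + exists m. split; auto. now exists m'.
  + exists m'. split; auto. exists m. split; auto.
    intros f Hf. rewrite Cdist_sym. auto.
- assert (Hcl : wclosure E0 (fun rho => exists m, b m = true /\ rho = evaluation E0 m) rho).
  { split; auto. intros V HV Vrho. destruct (HV rho Vrho) as (_ & l & e & He & Hl & Hnb).
    destruct (Hc l e Hl He) as (m & (Hm & _) & D).
    exists (evaluation E0 m). split; [|now exists m].
    apply Hnb; [now apply evaluation_character|].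
    intros f Hf. rewrite evaluation_in; auto. }
  destruct (Hopen rho Hcl) as (_ & l & e & He & Hl & Hnb).
  destruct (Hc l (e / 2) Hl) as (m & (_ & m' & Hm' & D') & D); [lra|].
  destruct (Hnb (evaluation E0 m')) as [_ Hcl'].
  + now apply evaluation_character.
  + intros f Hf. rewrite evaluation_in by auto.
    specialize (D f Hf). specialize (D' f Hf). rewrite Cdist_sym in D'.
    pose proof (Cdist_triangle (f m') (f m) (rho f)). lra.
  (* The indicator of [m'] tells the evaluations at [m'] and at any other position apart. *)
  + destruct (Hcl' _ (evaluation_isolated m') eq_refl) as (s & Es & m'' & Hm'' & Es').
    assert (E : evaluation E0 m'' (indicator (Nat.eqb m'))
              = evaluation E0 m' (indicator (Nat.eqb m'))) by congruence.
    rewrite !evaluation_in in E by apply E0_singleton.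
    unfold indicator in E. rewrite Nat.eqb_refl in E.
    destruct (Nat.eqb_spec m' m''); [congruence | injection E; lra].
Qed.

(* The binary digits of x occupy the positions x^2, ..., x^2 + 2x, so every finite
   0-1 word occurs. *)
Definition universal_bits (m : nat) : bool :=
  Nat.testbit (Nat.sqrt m) (m - Nat.sqrt m * Nat.sqrt m).

Lemma universal_bits_eq x i : (i <= 2 * x)%nat ->
  universal_bits (x * x + i) = Nat.testbit x i.
Proof.
intros Hi. unfold universal_bits. rewrite (Nat.sqrt_unique (x * x + i) x) by nia.
f_equal. lia.
Qed.

(** The [2^n] numbers [x] from [2^n] to [2^(n+1) - 1] differ in their lowest [n] bits, which form
    the windows at [x^2]. At precision 1/2 they need [2^n] colours, more than [exp (n/2)]. *)
Lemma universal_bits_not_low : ~ low_complexity (indicator universal_bits).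
Proof.
intros H. destruct (H (1 / 2) (1 / 2)) as [N0 HN]; [lra..|].
(* A positive length makes the comparison of [2^n] with [exp (1/2) ^ n] strict. *)
destruct (HN (S N0)) as (k & c & Bk & Lc & W); [lia|].
specialize (W _ (or_introl eq_refl)). set (n := S N0) in *.
set (p := (2 ^ n)%nat).
assert (Hp : (n < p)%nat) by (apply Nat.pow_gt_lin_r; lia).
assert (inj : forall x y, (p <= x < p + p)%nat -> (p <= y < p + p)%nat ->
  c (x * x)%nat = c (y * y)%nat -> x = y).
{ intros x y Hx Hy E.
  assert (M : (x mod p = y mod p)%nat).
  { apply Nat.bits_inj. intros i. unfold p. destruct (Nat.lt_ge_cases i n) as [Hi|Hi].
    - rewrite !Nat.mod_pow2_bits_low by auto. specialize (W _ _ E i Hi).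
      unfold indicator in W. rewrite !universal_bits_eq in W by lia.
      pose proof Cdist_C1_C0 as D. pose proof D as D'. rewrite Cdist_sym in D'.
      destruct (Nat.testbit x i), (Nat.testbit y i); auto; exfalso; lra.
    - now rewrite !Nat.mod_pow2_bits_high. }
  assert (R : forall z, (p <= z < p + p)%nat -> z mod p = (z - p)%nat).
  { intros z Hz. symmetry. apply (Nat.mod_unique z p 1); lia. }
  rewrite !R in M by auto. lia. }
assert (Hle : (p <= k)%nat).
{ rewrite <- (length_seq p p), <- (length_map (fun x => c (x * x)%nat)).
  rewrite <- (length_seq k 0). apply NoDup_incl_length.
  - apply NoDup_map_NoDup_ForallPairs; [|apply seq_NoDup].
    intros x y Hx Hy E. apply in_seq in Hx, Hy. now apply inj.
  - intros j Hj. apply in_map_iff in Hj. destruct Hj as (x & <- & _).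
    apply in_seq. specialize (Lc (x * x)%nat). lia. }
apply le_INR in Hle. unfold p in Hle. rewrite pow_INR in Hle.
assert (B : INR 2 ^ n <= exp (1 / 2) ^ n).
{ rewrite exp_pow, (Rmult_comm (INR n)). lra. }
assert (E2 : exp (1 / 2) < INR 2).
{ pose proof exp_le_3. pose proof (exp_pos (1 / 2)).
  assert (exp 1 = exp (1 / 2) * exp (1 / 2)) by (rewrite <- exp_plus; f_equal; lra).
  simpl INR. nra. }
assert (exp (1 / 2) ^ n < INR 2 ^ n); [|lra].
pose proof (exp_pos (1 / 2)).
assert (exp (1 / 2) ^ N0 <= INR 2 ^ N0) by (apply pow_incr; lra).
assert (0 < exp (1 / 2) ^ N0) by now apply pow_lt.
change (exp (1 / 2) * exp (1 / 2) ^ N0 < INR 2 * INR 2 ^ N0).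
apply Rlt_le_trans with (INR 2 * exp (1 / 2) ^ N0).
- now apply Rmult_lt_compat_r.
- apply Rmult_le_compat_l; lra.
Qed.

Theorem theorem1p5 :
  totally_disconnected E0 /\ ~ extremely_disconnected E0.
Proof.
split; [exact E0_totally_disconnected|]. intros H.
apply universal_bits_not_low, low_complexity_of_open_closure, H.
intros rho (m & Hm & ->). destruct (evaluation_isolated m _ eq_refl) as (Hc & l & e & He & Hl & Hnb).
split; auto. exists l, e. split; auto. split; auto.
intros s Hs D. exists m. auto.
Qed.
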